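(* Let $d\geq 1$ be an odd integer and let $k_0,k_1,k_2,k_3$ be nonzero scalars in $\mathbb{F}$ with $k_0^2=q^{-d-1}$. If the $\mathfrak{H}_q$-module $E(k_0,k_1,k_2,k_3)$ is irreducible, then the following hold: (i) $E(k_0,k_1,k_2,k_3)$ is isomorphic to the $\mathfrak{H}_q$-module $E(k_0,k_1^{-1},k_2,k_3)$. (ii) $E(k_0,k_1,k_2,k_3)$ is isomorphic to the $\mathfrak{H}_q$-module $E(k_0,k_1,k_2^{-1},k_3)$. (iii) $E(k_0,k_1,k_2,k_3)$ is isomorphic to the $\mathfrak{H}_q$-module $E(k_0,k_1,k_2,k_3^{-1})$.
   Context: $\mathbb{F}$ is a field and $q\in\mathbb{F}$ is nonzero. The universal DAHA $\mathfrak{H}_q$ of type $(C_1^\vee,C_1)$ is the unital associative $\mathbb{F}$-algebra with generators $t_0^{\pm1},t_1^{\pm1},t_2^{\pm1},t_3^{\pm1}$ and relations: $t_it_i^{-1}=t_i^{-1}t_i=1$ for all $i$; $t_i+t_i^{-1}$ is central for all $i$; $t_0t_1t_2t_3=q^{-1}$. For an odd integer $d\ge1$ and nonzero $k_0,k_1,k_2,k_3\in\mathbb{F}$ with $k_0^2=q^{-d-1}$, $E(k_0,k_1,k_2,k_3)$ denotes the $(d+1)$-dimensional $\mathfrak{H}_q$-module with $\mathbb{F}$-basis $\{v_i\}_{i=0}^d$ and action - $t_0v_i=k_0^{-1}q^{-i}(1-q^i)(1-k_0^2q^i)v_{i-1}+(k_0+k_0^{-1}-k_0^{-1}q^{-i})v_i$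 for $i=2,4,\ldots,d-1$; $t_0v_i=k_0^{-1}q^{-i-1}(v_i-v_{i+1})$ for $i=1,3,\ldots,d-2$; $t_0v_0=k_0v_0$; $t_0v_d=k_0v_d$; - $t_1v_i=-k_1(1-q^i)(1-k_0^2q^i)v_{i-1}+k_1v_i+k_1^{-1}v_{i+1}$ for $i=2,4,\ldots,d-1$; $t_1v_i=k_1^{-1}v_i$ for $i=1,3,\ldots,d$; $t_1v_0=k_1v_0+k_1^{-1}v_1$; - $t_2v_i=k_0^{-1}k_1^{-1}k_3^{-1}q^{-i-1}(v_i-v_{i+1})$ for $i=0,2,\ldots,d-1$; $t_2v_i=\frac{(k_0k_1k_3q^i-k_2)(k_0k_1k_3q^i-k_2^{-1})}{k_0k_1k_3q^i}v_{i-1}+(k_2+k_2^{-1}-k_0^{-1}k_1^{-1}k_3^{-1}q^{-i})v_i$ for $i=1,3,\ldots,d$; - $t_3v_i=k_3v_i$ for $i=0,2,\ldots,d-1$; $t_3v_i=-k_3^{-1}(k_0k_1k_3q^i-k_2)(k_0k_1k_3q^i-k_2^{-1})v_{i-1}+k_3^{-1}v_i+k_3v_{i+1}$ for $i=1,3,\ldots,d-2$; $t_3v_d=-k_3^{-1}(k_0k_1k_3q^d-k_2)(k_0k_1k_3q^d-k_2^{-1})v_{d-1}+k_3^{-1}v_d$. (These formulas do define an $\mathfrak{H}_q$-module.) *)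

(* Defs.v *)
From HB Require Import structures.
From mathcomp Require Import all_boot all_order all_algebra.
From mathcomp Require Import boolp.
From mathcomp Require Import ring.

Set Implicit Arguments.
Unset Strict Implicit.
Unset Printing Implicit Defensive.

Import GRing.Theory.
Local Open Scope ring_scope.
Local Open Scope quotient_scope.

Section Modules.
Variable R : pzRingType.

(* A boolean predicate is no restriction on the subsets of V, since every
   proposition is decidable by mathcomp.classical.boolp. *)
Definition irreducible_module (V : lmodType R) : Prop :=
  (exists v : V, v != 0) /\
  forall S : {pred V}, submod_closed S -> S =i pred1 0 \/ S =i predT.

Definition isomorphic_modules (V W : lmodType R) : Prop :=
  exists f : {linear V -> W}, bijective f.

End Modules.

Variant daha_index := I0 | I1 | I2 | I3.

(* Noncommutative F-algebra expressions in the letters t_i and t_i^{-1}. *)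
Inductive daha_expr (F : Type) : Type :=
| ECst of F
| EGen of daha_index
| EInv of daha_index
| EAdd of daha_expr F & daha_expr F
| EMul of daha_expr F & daha_expr F.

Arguments EGen {F}.
Arguments EInv {F}.

HB.instance Definition _ (F : Type) := gen_eqMixin (daha_expr F).
HB.instance Definition _ (F : Type) := gen_choiceMixin (daha_expr F).

Section Daha.
Variables (F : fieldType) (q : F).

Local Notation expr := (daha_expr F).
Local Notation "x +e y" := (EAdd x y) (at level 50, left associativity).
Local Notation "x *e y" := (EMul x y) (at level 40, left associativity).
Local Notation "c %:e" := (ECst c) (at level 2, format "c %:e").

(* The congruence generated by the axioms of unital associative F-algebras
   (opposite being multiplication by -1) and by the four defining relations
   of the algebra. *)
Inductive daha_cong : expr -> expr -> Prop :=
| cong_refl x : daha_cong x x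
| cong_sym x y : daha_cong x y -> daha_cong y x
| cong_trans y x z : daha_cong x y -> daha_cong y z -> daha_cong x z
| cong_add x x' y y' :
    daha_cong x x' -> daha_cong y y' -> daha_cong (x +e y) (x' +e y')
| cong_mul x x' y y' :
    daha_cong x x' -> daha_cong y y' -> daha_cong (x *e y) (x' *e y')
| cong_addA x y z : daha_cong (x +e (y +e z)) (x +e y +e z)
| cong_addC x y : daha_cong (x +e y) (y +e x)
| cong_add0 x : daha_cong (0%:e +e x) x
| cong_addN x : daha_cong ((-1)%:e *e x +e x) 0%:e
| cong_mulA x y z : daha_cong (x *e (y *e z)) (x *e y *e z)
| cong_mul1l x : daha_cong (1%:e *e x) x
| cong_mul1r x : daha_cong (x *e 1%:e) x
| cong_mulDl x y z : daha_cong ((x +e y) *e z) (x *e z +e y *e z)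
| cong_mulDr x y z : daha_cong (x *e (y +e z)) (x *e y +e x *e z)
| cong_cstD a b : daha_cong (a + b)%:e (a%:e +e b%:e)
| cong_cstM a b : daha_cong (a * b)%:e (a%:e *e b%:e)
| cong_cstC a x : daha_cong (a%:e *e x) (x *e a%:e)
| cong_genV i : daha_cong (EGen i *e EInv i) 1%:e
| cong_Vgen i : daha_cong (EInv i *e EGen i) 1%:e
| cong_central i x :
    daha_cong ((EGen i +e EInv i) *e x) (x *e (EGen i +e EInv i))
| cong_prod :
    daha_cong (EGen I0 *e EGen I1 *e EGen I2 *e EGen I3) (q^-1)%:e.

Definition daha_eq : rel expr := fun x y => `[< daha_cong x y >].

Lemma daha_eq_equiv : equiv_class_of daha_eq.
Proof.
split=> [x | x y | y x z].
- by apply/asboolP; apply: cong_refl.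
- by apply/asboolP/asboolP; apply: cong_sym.
- by move=> /asboolP xy /asboolP yz; apply/asboolP; apply: cong_trans xy yz.
Qed.

Canonical daha_equiv := EquivRelPack daha_eq_equiv.

(* The universal DAHA of type (C_1^vee, C_1). *)
Definition daha (hq : q != 0) : Type := {eq_quot daha_equiv}.

Variable hq : q != 0.
Local Notation H := (daha hq).

HB.instance Definition _ := Choice.copy H {eq_quot daha_equiv}.
HB.instance Definition _ := Quotient.copy H {eq_quot daha_equiv}.

Lemma daha_piP (x y : expr) :
  (\pi_H x = \pi_H y) <-> daha_cong x y.
Proof.
by split=> [/eqmodP/asboolP | ?]; last by apply/eqmodP/asboolP.
Qed.

Lemma daha_reprP (x : expr) : daha_cong (repr (\pi_H x)) x.
Proof. by apply/daha_piP; rewrite reprK. Qed.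

Definition daha_cst (c : F) : H := \pi_H c%:e.
Definition daha_add (x y : H) : H := \pi_H (repr x +e repr y).
Definition daha_mul (x y : H) : H := \pi_H (repr x *e repr y).
Definition daha_opp (x : H) : H := \pi_H ((-1)%:e *e repr x).

Lemma daha_addE x y : \pi_H (x +e y) = daha_add (\pi_H x) (\pi_H y).
Proof. by apply/daha_piP/cong_add; apply/cong_sym/daha_reprP. Qed.

Lemma daha_mulE x y : \pi_H (x *e y) = daha_mul (\pi_H x) (\pi_H y).
Proof. by apply/daha_piP/cong_mul; apply/cong_sym/daha_reprP. Qed.

Lemma daha_oppE x : daha_opp (\pi_H x) = daha_mul (daha_cst (-1)) (\pi_H x).
Proof. by rewrite -daha_mulE /daha_opp !daha_mulE reprK. Qed.

Lemma daha_ind (P : H -> Prop) : (forall x, P (\pi_H x)) -> forall x, P x.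
Proof. by move=> Px x; rewrite -[x]reprK. Qed.

Fact daha_addA : associative daha_add.
Proof.
elim/daha_ind=> x; elim/daha_ind=> y; elim/daha_ind=> z.
by rewrite -!daha_addE; apply/daha_piP/cong_addA.
Qed.

Fact daha_addC : commutative daha_add.
Proof.
elim/daha_ind=> x; elim/daha_ind=> y.
by rewrite -!daha_addE; apply/daha_piP/cong_addC.
Qed.

Fact daha_add0 : left_id (daha_cst 0) daha_add.
Proof.
by elim/daha_ind=> x; rewrite -!daha_addE; apply/daha_piP/cong_add0.
Qed.

Fact daha_addN : left_inverse (daha_cst 0) daha_opp daha_add.
Proof.
elim/daha_ind=> x; rewrite daha_oppE -daha_mulE -!daha_addE.
exact/daha_piP/cong_addN.
Qed.

Fact daha_mulA : associative daha_mul.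
Proof.
elim/daha_ind=> x; elim/daha_ind=> y; elim/daha_ind=> z.
by rewrite -!daha_mulE; apply/daha_piP/cong_mulA.
Qed.

Fact daha_mul1l : left_id (daha_cst 1) daha_mul.
Proof.
by elim/daha_ind=> x; rewrite -!daha_mulE; apply/daha_piP/cong_mul1l.
Qed.

Fact daha_mul1r : right_id (daha_cst 1) daha_mul.
Proof.
by elim/daha_ind=> x; rewrite -!daha_mulE; apply/daha_piP/cong_mul1r.
Qed.

Fact daha_mulDl : left_distributive daha_mul daha_add.
Proof.
elim/daha_ind=> x; elim/daha_ind=> y; elim/daha_ind=> z.
by rewrite -!(daha_addE, daha_mulE); apply/daha_piP/cong_mulDl.
Qed.

Fact daha_mulDr : right_distributive daha_mul daha_add.
Proof.
elim/daha_ind=> x; elim/daha_ind=> y; elim/daha_ind=> z.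
by rewrite -!(daha_addE, daha_mulE); apply/daha_piP/cong_mulDr.
Qed.

HB.instance Definition _ := GRing.isPzRing.Build H daha_addA daha_addC
  daha_add0 daha_addN daha_mulA daha_mul1l daha_mul1r daha_mulDl daha_mulDr.

Lemma daha_piD x y : \pi_H (x +e y) = \pi_H x + \pi_H y.
Proof. exact: daha_addE. Qed.

Lemma daha_piM x y : \pi_H (x *e y) = \pi_H x * \pi_H y.
Proof. exact: daha_mulE. Qed.

Lemma daha_cstD a b : daha_cst (a + b) = daha_cst a + daha_cst b.
Proof. by rewrite /daha_cst -daha_piD; apply/daha_piP/cong_cstD. Qed.

Lemma daha_cstM a b : daha_cst (a * b) = daha_cst a * daha_cst b.
Proof. by rewrite /daha_cst -daha_piM; apply/daha_piP/cong_cstM. Qed.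

Lemma daha_cstC a (x : H) : daha_cst a * x = x * daha_cst a.
Proof.
elim/daha_ind: x => x; rewrite /daha_cst -!daha_piM.
exact/daha_piP/cong_cstC.
Qed.

Definition daha_t (i : daha_index) : H := \pi_H (EGen i).
Definition daha_tV (i : daha_index) : H := \pi_H (EInv i).

(* The universal property: a family in an F-algebra A satisfying the defining
   relations extends to a ring morphism from the algebra to A. *)
Section Lift.
Variables (A : algType F) (T TV : daha_index -> A).

Definition daha_rel : Prop :=
  [/\ forall i, T i * TV i = 1, forall i, TV i * T i = 1,
      forall i x, GRing.comm (T i + TV i) x
    & T I0 * T I1 * T I2 * T I3 = q^-1%:A].

Fixpoint daha_eval (x : expr) : A :=
  match x with
  | ECst c => c%:A
  | EGen i => T i
  | EInv i => TV i
  | EAdd x y => daha_eval x + daha_eval y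
  | EMul x y => daha_eval x * daha_eval y
  end.

Definition daha_lift (x : H) : A := daha_eval (repr x).

Hypothesis relT : daha_rel.

Lemma daha_eval_cong x y : daha_cong x y -> daha_eval x = daha_eval y.
Proof.
have [TTV TVT Tc Tq] := relT.
elim=> //=.
- by move=> ? ? ? _ -> _ ->.
- by move=> ? ? ? ? _ -> _ ->.
- by move=> ? ? ? ? _ -> _ ->.
- by move=> *; rewrite addrA.
- by move=> *; rewrite addrC.
- by move=> *; rewrite scale0r add0r.
- by move=> *; rewrite scaleN1r mulN1r addNr scale0r.
- by move=> *; rewrite mulrA.
- by move=> *; rewrite scale1r mul1r.
- by move=> *; rewrite scale1r mulr1.
- by move=> *; rewrite mulrDl.
- by move=> *; rewrite mulrDr.
- by move=> *; rewrite scalerDl.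
- by move=> *; rewrite mulr_algl scalerA.
- by move=> *; rewrite mulr_algl mulr_algr.
- by move=> i; rewrite TTV scale1r.
- by move=> i; rewrite TVT scale1r.
- by move=> i z; apply: Tc.
Qed.

Lemma daha_lift_pi x : daha_lift (\pi_H x) = daha_eval x.
Proof. exact/daha_eval_cong/daha_reprP. Qed.

Lemma daha_lift_cst c : daha_lift (daha_cst c) = c%:A.
Proof. exact: daha_lift_pi. Qed.

Lemma daha_lift_t i : daha_lift (daha_t i) = T i.
Proof. exact: daha_lift_pi. Qed.

Lemma daha_lift_tV i : daha_lift (daha_tV i) = TV i.
Proof. exact: daha_lift_pi. Qed.

Lemma daha_lift1 : daha_lift 1 = 1.
Proof. by rewrite daha_lift_cst scale1r. Qed.

Lemma daha_liftD x y : daha_lift (x + y) = daha_lift x + daha_lift y.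
Proof. exact: daha_lift_pi. Qed.

Lemma daha_liftM x y : daha_lift (x * y) = daha_lift x * daha_lift y.
Proof. exact: daha_lift_pi. Qed.

End Lift.

(* The algebra is not zero: it has the one-dimensional representation
   t_0 = q^{-1}, t_1 = t_2 = t_3 = 1. *)
Fact daha_oner_neq0 : 1 != 0 :> H.
Proof.
pose T i : F^o := if i is I0 then q^-1 else 1.
pose TV i : F^o := if i is I0 then q else 1.
have relT : daha_rel T TV.
  split=> [[] | [] | i x | ]; rewrite /T /TV ?mulr1 ?mulVf ?divff //.
    exact: mulrC.
  by rewrite /GRing.scale /= !mulr1.
apply/eqP=> /(congr1 (daha_lift T TV)) /eqP.
by rewrite !daha_lift_cst // scale1r scale0r oner_eq0.
Qed.

HB.instance Definition _ := GRing.PzSemiRing_isNonZero.Build H daha_oner_neq0.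

Definition daha_scale (c : F) (x : H) : H := daha_cst c * x.

Fact daha_scaleA a b v :
  daha_scale a (daha_scale b v) = daha_scale (a * b) v.
Proof. by rewrite /daha_scale mulrA -daha_cstM. Qed.

Fact daha_scale1 : left_id 1 daha_scale.
Proof. by move=> x; apply: mul1r. Qed.

Fact daha_scaleDr : right_distributive daha_scale +%R.
Proof. by move=> *; apply: mulrDr. Qed.

Fact daha_scaleDl v : {morph daha_scale^~ v : a b / a + b}.
Proof. by move=> a b; rewrite /daha_scale daha_cstD mulrDl. Qed.

HB.instance Definition _ := GRing.Zmodule_isLmodule.Build F H
  daha_scaleA daha_scale1 daha_scaleDr daha_scaleDl.

Fact daha_scaleAl (a : F) (x y : H) : a *: (x * y) = (a *: x) * y.
Proof. exact: mulrA. Qed.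

HB.instance Definition _ := GRing.Lmodule_isLalgebra.Build F H daha_scaleAl.

Fact daha_scaleAr (a : F) (x y : H) : a *: (x * y) = x * (a *: y).
Proof.
by rewrite /GRing.scale /= /daha_scale mulrA daha_cstC -mulrA.
Qed.

HB.instance Definition _ := GRing.Lalgebra_isAlgebra.Build F H daha_scaleAr.

Lemma daha_tVK i : daha_t i * daha_tV i = 1.
Proof. by rewrite -daha_piM; apply/daha_piP/cong_genV. Qed.

Lemma daha_tK i : daha_tV i * daha_t i = 1.
Proof. by rewrite -daha_piM; apply/daha_piP/cong_Vgen. Qed.

Lemma daha_t_central i (x : H) : GRing.comm (daha_t i + daha_tV i) x.
Proof.
elim/daha_ind: x => x; rewrite /GRing.comm -daha_piD -!daha_piM.
exact/daha_piP/cong_central.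
Qed.

Lemma daha_t_prod :
  daha_t I0 * daha_t I1 * daha_t I2 * daha_t I3 = (q^-1)%:A :> H.
Proof.
have -> : (q^-1)%:A = daha_cst q^-1 by apply: mulr1.
by rewrite /daha_t -!daha_piM; apply/daha_piP/cong_prod.
Qed.

End Daha.

Section BasisVectors.
Variables (F : fieldType) (q : F) (d : nat) (k0 k1 k2 k3 : F).

(* v_i, which is 0 for i > d. *)
Definition daha_v (i : nat) : 'cV[F]_d.+1 := \col_(r < d.+1) (r == i :> nat)%:R.

Local Notation v := daha_v.

Definition t0_v (i : nat) : 'cV[F]_d.+1 :=
  if i == 0%N then k0 *: v 0
  else if i == d then k0 *: v d
  else if odd i then (k0^-1 * q ^- i.+1) *: (v i - v i.+1)
  else (k0^-1 * q ^- i * (1 - q ^+ i) * (1 - k0 ^+ 2 * q ^+ i)) *: v i.-1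
       + (k0 + k0^-1 - k0^-1 * q ^- i) *: v i.

Definition t1_v (i : nat) : 'cV[F]_d.+1 :=
  if i == 0%N then k1 *: v 0 + k1^-1 *: v 1
  else if odd i then k1^-1 *: v i
  else - (k1 * (1 - q ^+ i) * (1 - k0 ^+ 2 * q ^+ i)) *: v i.-1
       + k1 *: v i + k1^-1 *: v i.+1.

Definition t2_v (i : nat) : 'cV[F]_d.+1 :=
  if odd i then
    ((k0 * k1 * k3 * q ^+ i - k2) * (k0 * k1 * k3 * q ^+ i - k2^-1)
       / (k0 * k1 * k3 * q ^+ i)) *: v i.-1
    + (k2 + k2^-1 - k0^-1 * k1^-1 * k3^-1 * q ^- i) *: v i
  else (k0^-1 * k1^-1 * k3^-1 * q ^- i.+1) *: (v i - v i.+1).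

Definition t3_v (i : nat) : 'cV[F]_d.+1 :=
  if i == d then
    - (k3^-1 * (k0 * k1 * k3 * q ^+ d - k2) * (k0 * k1 * k3 * q ^+ d - k2^-1))
      *: v d.-1 + k3^-1 *: v d
  else if odd i then
    - (k3^-1 * (k0 * k1 * k3 * q ^+ i - k2) * (k0 * k1 * k3 * q ^+ i - k2^-1))
      *: v i.-1 + k3^-1 *: v i + k3 *: v i.+1
  else k3 *: v i.

Definition t_v (i : daha_index) : nat -> 'cV[F]_d.+1 :=
  match i with I0 => t0_v | I1 => t1_v | I2 => t2_v | I3 => t3_v end.

(* The matrix whose j-th column is t_i v_j. *)
Definition t_mx (i : daha_index) : 'M[F]_d.+1 := \matrix_(r, j) t_v i j r 0.

Lemma t_mxE i j : (j <= d)%N -> t_mx i *m v j = t_v i j.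
Proof.
move=> jd; apply/colP=> r; rewrite mxE (bigD1 (Ordinal (jd : (j < d.+1)%N))) //=.
rewrite !mxE /= eqxx mulr1 big1 ?addr0 // => s nsj.
by rewrite !mxE -(inj_eq val_inj) /= in nsj *; rewrite (negPf nsj) mulr0.
Qed.

Lemma daha_v_out i : (d < i)%N -> v i = 0.
Proof.
by move=> di; apply/colP=> r; rewrite !mxE ltn_eqF // (leq_trans _ di).
Qed.

Lemma eq_on_v m (A B : 'M[F]_(m, d.+1)) :
  (forall j, (j <= d)%N -> A *m v j = B *m v j) -> A = B.
Proof.
move=> AB; apply/matrixP=> r s; have := AB s (leq_ord s).
have E (C : 'M[F]_(m, d.+1)) : (C *m v s) r 0 = C r s.
  rewrite mxE (bigD1 s) //= !mxE eqxx mulr1 big1 ?addr0 // => t nts.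
  by rewrite !mxE -(inj_eq val_inj) /= in nts *; rewrite (negPf nts) mulr0.
by move=> /(congr1 (fun C : 'M[F]_(m, 1) => C r 0)); rewrite !E.
Qed.

Hypotheses (hd : odd d) (hk0 : k0 != 0) (hk1 : k1 != 0) (hk2 : k2 != 0)
  (hk3 : k3 != 0) (hk : k0 ^+ 2 = q ^- d.+1).

Let q0 : q != 0.
Proof.
apply: contraNneq hk0 => qz; have /eqP := hk.
by rewrite qz expr0n /= invr0 sqrf_eq0.
Qed.

Let qX i : q ^+ i != 0. Proof. by rewrite expf_neq0. Qed.

Let even_ltd j : ~~ odd j -> (j <= d)%N -> (j < d)%N.
Proof.
by move=> ej; rewrite leq_eqVlt => /orP[/eqP jd | //]; rewrite jd hd in ej.
Qed.

Let hkq : k0 ^+ 2 * q ^+ d.+1 = 1.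
Proof. by rewrite hk mulVf. Qed.

Let odd_gtd j : odd j -> (d < j)%N -> [/\ v j.-1 = 0, v j = 0 & v j.+1 = 0].
Proof.
case: j => //= j ej; rewrite ltnS leq_eqVlt => /orP[/eqP jd | dj].
  by rewrite -jd hd in ej.
by split; apply: daha_v_out; rewrite ?ltnS // ltnW // ltnW.
Qed.

Let even_gtd j : ~~ odd j -> (d < j)%N ->
  [/\ (1 - k0 ^+ 2 * q ^+ j) *: v j.-1 = 0, v j = 0 & v j.+1 = 0].
Proof.
move=> ej dj; split; [| exact: daha_v_out | exact/daha_v_out/ltnW].
move: dj; rewrite leq_eqVlt => /orP[/eqP <- | dj].
  by rewrite hkq subrr scale0r.
by case: j dj {ej} => // j dj; rewrite daha_v_out ?scaler0.
Qed.

(* Thanks to k_0^2 = q^{-d-1} and to v_i = 0 for i > d, the boundary cases are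
   instances of the general ones. *)
Lemma t0_mx_odd j : odd j ->
  t_mx I0 *m v j = (k0^-1 * q ^- j.+1) *: (v j - v j.+1).
Proof.
move=> oj; have [jd | dj] := leqP j d; last first.
  by have [_ -> ->] := odd_gtd oj dj; rewrite mulmx0 subrr scaler0.
rewrite t_mxE //= /t0_v; case: eqP oj => [-> // | _ oj].
case: eqP => [-> | _]; last by rewrite oj.
rewrite (@daha_v_out d.+1) // subr0 -hk; congr (_ *: _).
by rewrite expr2 mulKf.
Qed.

Lemma t0_mx_even j : ~~ odd j ->
  t_mx I0 *m v j =
    (k0^-1 * q ^- j * (1 - q ^+ j) * (1 - k0 ^+ 2 * q ^+ j)) *: v j.-1
    + (k0 + k0^-1 - k0^-1 * q ^- j) *: v j.
Proof.
move=> ej; have [jd | dj] := leqP j d; last first.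
  have [vp -> _] := even_gtd ej dj.
  by rewrite -scalerA vp mulmx0 !scaler0 addr0.
rewrite t_mxE //= /t0_v; case: eqP ej => [-> _ | _ ej].
  by rewrite expr0 subrr invr1 !mulr1 mulr0 mul0r scale0r add0r addrK.
by rewrite (ltn_eqF (even_ltd _ _)) // (negPf ej).
Qed.

Lemma t1_mx_odd j : odd j -> t_mx I1 *m v j = k1^-1 *: v j.
Proof.
move=> oj; have [jd | dj] := leqP j d; last first.
  by have [_ -> _] := odd_gtd oj dj; rewrite mulmx0 scaler0.
by rewrite t_mxE //= /t1_v oj; case: eqP oj => [->|].
Qed.

Lemma t1_mx_even j : ~~ odd j ->
  t_mx I1 *m v j =
    - (k1 * (1 - q ^+ j) * (1 - k0 ^+ 2 * q ^+ j)) *: v j.-1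
    + k1 *: v j + k1^-1 *: v j.+1.
Proof.
move=> ej; have [jd | dj] := leqP j d; last first.
  have [vp -> ->] := even_gtd ej dj.
  by rewrite scaleNr -scalerA vp mulmx0 !scaler0 oppr0 !addr0.
rewrite t_mxE //= /t1_v; case: eqP ej => [-> _ | _ ej].
  by rewrite expr0 subrr mulr0 mul0r oppr0 scale0r add0r.
by rewrite (negPf ej).
Qed.

Lemma t2_mx_odd j : odd j ->
  t_mx I2 *m v j =
    ((k0 * k1 * k3 * q ^+ j - k2) * (k0 * k1 * k3 * q ^+ j - k2^-1)
       / (k0 * k1 * k3 * q ^+ j)) *: v j.-1
    + (k2 + k2^-1 - k0^-1 * k1^-1 * k3^-1 * q ^- j) *: v j.
Proof.
move=> oj; have [jd | dj] := leqP j d; last first.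
  by have [-> -> _] := odd_gtd oj dj; rewrite mulmx0 !scaler0 addr0.
by rewrite t_mxE //= /t2_v oj.
Qed.

Lemma t2_mx_even j : ~~ odd j ->
  t_mx I2 *m v j = (k0^-1 * k1^-1 * k3^-1 * q ^- j.+1) *: (v j - v j.+1).
Proof.
move=> ej; have [jd | dj] := leqP j d; last first.
  by have [_ -> ->] := even_gtd ej dj; rewrite mulmx0 subrr scaler0.
by rewrite t_mxE //= /t2_v (negPf ej).
Qed.

Lemma t3_mx_odd j : odd j ->
  t_mx I3 *m v j =
    - (k3^-1 * (k0 * k1 * k3 * q ^+ j - k2) * (k0 * k1 * k3 * q ^+ j - k2^-1))
      *: v j.-1 + k3^-1 *: v j + k3 *: v j.+1.
Proof.
move=> oj; have [jd | dj] := leqP j d; last first.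
  by have [-> -> ->] := odd_gtd oj dj; rewrite mulmx0 !scaler0 !addr0.
rewrite t_mxE //= /t3_v; case: eqP => [-> | _]; last by rewrite oj.
by rewrite (@daha_v_out d.+1) // scaler0 addr0.
Qed.

Lemma t3_mx_even j : ~~ odd j -> t_mx I3 *m v j = k3 *: v j.
Proof.
move=> ej; have [jd | dj] := leqP j d; last first.
  by have [_ -> _] := even_gtd ej dj; rewrite mulmx0 scaler0.
by rewrite t_mxE //= /t3_v (ltn_eqF (even_ltd _ _)) // (negPf ej).
Qed.

Definition t_even j (ej : ~~ odd j) :=
  (t0_mx_even ej, t1_mx_even ej, t2_mx_even ej, t3_mx_even ej).
Definition t_odd j (oj : odd j) := (t0_mx_odd oj, t1_mx_odd oj, t2_mx_odd oj, t3_mx_odd oj).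

Let mx_linE := (mulmxDr, mulmxN, =^~ scalemxAr).

Let eq_on_v0SS m (A B : 'M[F]_(m, d.+1)) :
  A *m v 0 = B *m v 0 -> A *m v 1 = B *m v 1 ->
  (forall j, odd j -> A *m v j.+1 = B *m v j.+1) ->
  (forall j, ~~ odd j -> A *m v j.+3 = B *m v j.+3) ->
  A = B.
Proof.
move=> A0 A1 Ae Ao; apply: eq_on_v => [[|[|j]]] // _.
have [oj | ej] := boolP (odd j); last exact: Ae.
by case: j oj => //= j; apply: Ao.
Qed.

Definition t_k (i : daha_index) : F :=
  match i with I0 => k0 | I1 => k1 | I2 => k2 | I3 => k3 end.

Lemma t_mx_quadratic i :
  t_mx i * t_mx i = (t_k i + (t_k i)^-1) *: t_mx i - 1%:M.
Proof.
apply: eq_on_v0SS => [||j oj|j ej]; rewrite mulmxBl mul1mx -scalemxAl -mulmxA.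
- have [e0 o1] : ~~ odd 0 /\ odd 1 by [].
  case: i; rewrite /= !(mx_linE, t_even e0, t_odd o1) ?expr0 /=;
  move: (v 0) (v 1) => a b; apply/colP=> r; rewrite !mxE; field;
  by rewrite ?oner_eq0 ?hk0 ?hk1 ?hk2 ?hk3 ?q0.
- have [e0 o1 e2] : [/\ ~~ odd 0, odd 1 & ~~ odd 2] by [].
  case: i; rewrite /= !(mx_linE, t_even e0, t_odd o1, t_even e2) ?expr0 /=;
  move: (v 0) (v 1) (v 2) => a b c; apply/colP=> r; rewrite !mxE; field;
  by rewrite ?oner_eq0 ?hk0 ?hk1 ?hk2 ?hk3 ?q0.
- have [e1 o2] : ~~ odd j.+1 /\ odd j.+2 by rewrite /= negbK oj.
  case: i; rewrite /= !(mx_linE, t_odd oj, t_even e1, t_odd o2) /=;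
  have := qX j; rewrite ?exprS; move: (q ^+ j) => Q Q0;
  move: (v j) (v j.+1) (v j.+2) => a b c; apply/colP=> r; rewrite !mxE; field;
  by rewrite ?oner_eq0 ?hk0 ?hk1 ?hk2 ?hk3 ?q0 ?Q0.
- have [o1 e2] : odd j.+1 /\ ~~ odd j.+2 by rewrite /= negbK ej.
  have [o3 e4] : odd j.+3 /\ ~~ odd j.+4 by rewrite /= !negbK ej.
  case: i; rewrite /= !(mx_linE, t_odd o1, t_even e2, t_odd o3, t_even e4) /=;
  have := qX j; rewrite ?exprS; move: (q ^+ j) => Q Q0;
  move: (v j.+1) (v j.+2) (v j.+3) (v j.+4) => a b c e;
  apply/colP=> r; rewrite !mxE; field;
  by rewrite ?oner_eq0 ?hk0 ?hk1 ?hk2 ?hk3 ?q0 ?Q0.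
Qed.

Lemma t_mx_unit i : t_mx i \is a GRing.unit.
Proof.
pose c := t_k i + (t_k i)^-1.
have E : t_mx i * (c *: 1%:M - t_mx i) = 1.
  by rewrite mulrBr t_mx_quadratic -scalerAr mulr1 opprB addrC subrK.
by case/mulmx1_unit: E.
Qed.

Lemma t_mxDV i : t_mx i + (t_mx i)^-1 = (t_k i + (t_k i)^-1)%:A.
Proof.
apply: (mulrI (t_mx_unit i)).
by rewrite mulrDr mulrV ?t_mx_unit // t_mx_quadratic subrK -scalerAr mulr1.
Qed.

Lemma t_mx_prod : t_mx I0 * t_mx I1 * t_mx I2 * t_mx I3 = q^-1%:A.
Proof.
apply: eq_on_v0SS => [||j oj|j ej]; rewrite -scalemxAl mul1mx -!mulmxA.
- have [e0 o1] : ~~ odd 0 /\ odd 1 by [].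
  rewrite /= !(mx_linE, t_even e0, t_odd o1) ?expr0 /=.
  move: (v 0) (v 1) (v 2) => a b c; apply/colP=> r; rewrite !mxE; field.
  by rewrite ?oner_eq0 ?hk0 ?hk1 ?hk2 ?hk3 ?q0.
- have [e0 o1 e2 o3] : [/\ ~~ odd 0, odd 1, ~~ odd 2 & odd 3] by [].
  rewrite /= !(mx_linE, t_even e0, t_odd o1, t_even e2, t_odd o3) ?expr0 /=.
  move: (v 0) (v 1) (v 2) (v 3) (v 4) => a b c e f; apply/colP=> r.
  by rewrite !mxE; field; rewrite ?oner_eq0 ?hk0 ?hk1 ?hk2 ?hk3 ?q0.
- have [e1 o2] : ~~ odd j.+1 /\ odd j.+2 by rewrite /= negbK oj.
  rewrite /= !(mx_linE, t_odd oj, t_even e1, t_odd o2) /=.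
  have := qX j; rewrite ?exprS; move: (q ^+ j) => Q Q0.
  move: (v j) (v j.+1) (v j.+2) (v j.+3) => a b c e; apply/colP=> r.
  by rewrite !mxE; field; rewrite ?oner_eq0 ?hk0 ?hk1 ?hk2 ?hk3 ?q0 ?Q0.
- have [o1 e2] : odd j.+1 /\ ~~ odd j.+2 by rewrite /= negbK ej.
  have [o3 e4] : odd j.+3 /\ ~~ odd j.+4 by rewrite /= !negbK ej.
  have o5 : odd j.+4.+1 by rewrite /= !negbK ej.
  rewrite /= !(mx_linE, t_odd o1, t_even e2, t_odd o3, t_even e4, t_odd o5) /=.
  have := qX j; rewrite ?exprS; move: (q ^+ j) => Q Q0.
  move: (v j.+1) (v j.+2) (v j.+3) (v j.+4) (v j.+4.+1) (v j.+4.+2).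
  move=> a b c e f g; apply/colP=> r.
  by rewrite !mxE; field; rewrite ?oner_eq0 ?hk0 ?hk1 ?hk2 ?hk3 ?q0 ?Q0.
Qed.

Lemma t_mx_rel : daha_rel q t_mx (fun i => (t_mx i)^-1).
Proof.
split=> [i | i | i x | ]; last exact: t_mx_prod.
- by rewrite mulrV ?t_mx_unit.
- by rewrite mulVr ?t_mx_unit.
- by rewrite t_mxDV /GRing.comm mulr_algl mulr_algr.
Qed.

End BasisVectors.

Section ModuleE.
Variables (F : fieldType) (q : F) (d : nat) (k0 k1 k2 k3 : F).

(* v_i is the i-th standard basis vector.  The canonical scalars of E are those
   of daha hq, not F; c in F acts through c%:A, see E_cst. *)
Definition E (hq : q != 0) (hd : odd d) (hk0 : k0 != 0) (hk1 : k1 != 0)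
    (hk2 : k2 != 0) (hk3 : k3 != 0) (hk : k0 ^+ 2 = q ^- d.+1) : Type :=
  'cV[F]_d.+1.

Variables (hq : q != 0) (hd : odd d) (hk0 : k0 != 0) (hk1 : k1 != 0).
Variables (hk2 : k2 != 0) (hk3 : k3 != 0) (hk : k0 ^+ 2 = q ^- d.+1).

Local Notation M := (E hq hd hk0 hk1 hk2 hk3 hk).
Local Notation T := (t_mx q d k0 k1 k2 k3).
Local Notation lift := (daha_lift T (fun i => (T i)^-1)).

HB.instance Definition _ := GRing.Zmodule.copy M 'cV[F]_d.+1.

Let relT := t_mx_rel hd hk0 hk1 hk2 hk3 hk.

Definition E_scale (h : daha hq) (x : M) : M := lift h *m (x : 'cV[F]_d.+1).

Fact E_scaleA a b x : E_scale a (E_scale b x) = E_scale (a * b) x.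
Proof. by rewrite /E_scale mulmxA daha_liftM. Qed.

Fact E_scale1 : left_id 1 E_scale.
Proof. by move=> x; rewrite /E_scale daha_lift1 // mul1mx. Qed.

Fact E_scaleDr : right_distributive E_scale +%R.
Proof. by move=> a x y; apply: mulmxDr. Qed.

Fact E_scaleDl x : {morph E_scale^~ x : a b / a + b}.
Proof. by move=> a b; rewrite /E_scale daha_liftD // mulmxDl. Qed.

HB.instance Definition _ := GRing.Zmodule_isLmodule.Build (daha hq) M
  E_scaleA E_scale1 E_scaleDr E_scaleDl.

Lemma E_t_v i j : (j <= d)%N ->
  daha_t hq i *: (daha_v F d j : M) = t_v q d k0 k1 k2 k3 i j.
Proof. by move=> jd; rewrite -t_mxE // -(daha_lift_t hq relT i). Qed.

Lemma E_cst c (x : M) : c%:A *: x = c *: (x : 'cV[F]_d.+1).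
Proof.
have -> : c%:A = daha_cst hq c by apply: mulr1.
by rewrite /GRing.scale /= /E_scale daha_lift_cst // -scalemxAl mul1mx.
Qed.

End ModuleE.

Arguments E {F q d} k0 k1 k2 k3 hq hd hk0 hk1 hk2 hk3 hk.

(* Main.v *)
Require Import Defs.
From HB Require Import structures.
From mathcomp Require Import all_boot all_order all_algebra.
From mathcomp Require Import ring zify.

Set Implicit Arguments.
Unset Strict Implicit.
Unset Printing Implicit Defensive.

Import GRing.Theory.
Local Open Scope ring_scope.

(** The three isomorphisms have one source.  Given any representation with the
    same values of k_i + k_i^-1, a vector w_0 with t_0 w_0 = k_0 w_0 and
    t_3 w_0 = k_3 w_0 generates a sequence w_0, w_1, w_2, ... on which the t_i
    act by the formulas that define E: these formulas are forced by the
    quadratic relations and by t_0 t_1 t_2 t_3 = q^-1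
    ([standard_family_exists]).  If moreover w_(d+1) = 0, then v_j |-> w_j is a
    homomorphism from E(k_0, k_1, k_2, k_3).  So to compare E(k_0, ..., k_3)
    with the module of parameters k_0, k_1', k_2', k_3', where each k_i' is k_i
    or its inverse, it suffices to find in the former a nonzero w_0 with
    t_0 w_0 = k_0 w_0 and t_3 w_0 = k_3' w_0, and to show that the sequence it
    generates with the new parameters stops at w_(d+1) = 0; the homomorphism is
    then onto because E is irreducible, and bijective by dimension
    ([intertwiner_unit]).

    The sequence stops for the following reason.  Up to a nonzero scalar and a
    power of X = t_0 t_1, w_(2m) is P_m(X) w_0 for an explicit polynomial P_m
    ([Xpow_even]).  When 2m = d + 1, the condition on k_0^2 pairs the roots of
    P_m into k_0 k_1 q^(2j) and k_0 k_1^-1 q^(2j), so that P_m depends only on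
    k_1 + k_1^-1 ([verma_polyE]).  As v_(d+1) = 0 in E, P_m(X) kills v_0, hence
    all of E ([family_annihilated]), and in particular w_0.

    When k_1 or k_2 is inverted, v_0 itself is a suitable w_0.  When k_3 is
    inverted, w_0 comes from a count ([eigenvector_inv]): the k_0-eigenspace of
    t_0 contains (d+3)/2 independent vectors, which t_3 - k_3^-1 sends into
    the span of the (d+1)/2 vectors v_0, v_2, ..., v_(d-1). *)

(** * The sequence generated by a common eigenvector of t_0 and t_3 *)

Section StandardFamily.
Variables (F : fieldType) (q : F) (n : nat) (k0 k1 k2 k3 : F).
Variable T : daha_index -> 'M[F]_n.+1.

(** The factor 1 - q^j makes the value w 0.-1 = w 0 harmless.  There is no upper
    bound on j, so that E itself is an instance, with w_j = 0 for j > d. *)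
Definition standard_family (w : nat -> 'cV[F]_n.+1) : Prop :=
  (forall j, ~~ odd j ->
    [/\ T I0 *m w j =
          (k0^-1 * q ^- j * (1 - q ^+ j) * (1 - k0 ^+ 2 * q ^+ j)) *: w j.-1
          + (k0 + k0^-1 - k0^-1 * q ^- j) *: w j,
        T I1 *m w j =
          - (k1 * (1 - q ^+ j) * (1 - k0 ^+ 2 * q ^+ j)) *: w j.-1
          + k1 *: w j + k1^-1 *: w j.+1,
        T I2 *m w j =
          (k0^-1 * k1^-1 * k3^-1 * q ^- j.+1) *: (w j - w j.+1)
      & T I3 *m w j = k3 *: w j]) /\
  (forall j, odd j ->
    [/\ T I0 *m w j = (k0^-1 * q ^- j.+1) *: (w j - w j.+1),
        T I1 *m w j = k1^-1 *: w j,
        T I2 *m w j =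
          ((k0 * k1 * k3 * q ^+ j - k2) * (k0 * k1 * k3 * q ^+ j - k2^-1)
             / (k0 * k1 * k3 * q ^+ j)) *: w j.-1
          + (k2 + k2^-1 - k0^-1 * k1^-1 * k3^-1 * q ^- j) *: w j
      & T I3 *m w j =
          - (k3^-1 * (k0 * k1 * k3 * q ^+ j - k2)
               * (k0 * k1 * k3 * q ^+ j - k2^-1)) *: w j.-1
          + k3^-1 *: w j + k3 *: w j.+1]).

Hypotheses (hq : q != 0) (hk0 : k0 != 0) (hk1 : k1 != 0).
Hypotheses (hk2 : k2 != 0) (hk3 : k3 != 0).

Local Notation c i := (t_k k0 k1 k2 k3 i + (t_k k0 k1 k2 k3 i)^-1).

Hypothesis quadT : forall i, T i * T i = c i *: T i - 1%:M.
Hypothesis prodT : T I0 * T I1 * T I2 * T I3 = q^-1%:A.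

Let mx_linE := (mulmxDr, mulmxN, =^~ scalemxAr).

Lemma quadratic_mulmx i (x : 'cV[F]_n.+1) :
  T i *m (T i *m x) = c i *: (T i *m x) - x.
Proof.
by rewrite mulmxA [T i *m T i]quadT mulmxBl mul1mx scalemxAl.
Qed.

(** The quadratic relation makes k_i + k_i^-1 - t_i the inverse of t_i. *)
Lemma quadratic_solve i (x y : 'cV[F]_n.+1) :
  T i *m x = y -> x = c i *: y - T i *m y.
Proof. by move=> <-; rewrite quadratic_mulmx opprB addrC subrK. Qed.

Lemma prod_mulmx (x : 'cV[F]_n.+1) :
  T I0 *m (T I1 *m (T I2 *m (T I3 *m x))) = q^-1 *: x.
Proof.
by rewrite !mulmxA [_ *m T I3]prodT -scalemxAl mul1mx.
Qed.

(** The product of the four t_i is scalar, so it may be rotated cyclically. *)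
Lemma prod_mulmx_rot (x : 'cV[F]_n.+1) :
  T I3 *m (T I0 *m (T I1 *m (T I2 *m x))) = q^-1 *: x.
Proof.
have E : (q *: (T I0 * T I1 * T I2)) *m T I3 = 1%:M.
  by rewrite -scalemxAl [_ *m T I3]prodT scalerA divff // scale1r.
have := mulmx1C E; rewrite -scalemxAr => {}E.
apply: (scalerI hq); rewrite scalerA divff // scale1r.
by rewrite -[RHS]mul1mx -E -scalemxAl !mulmxA.
Qed.

(** The inductive step, with Q = q^j for an even j and p, e, o, e' standing for
    w_(j-1), w_j, w_(j+1), w_(j+2).  The last two hypotheses are the definitions
    of o and e'; the relations then determine the rest, including what the next
    step needs about o and e'. *)
Lemma standard_step (Q : F) (p e o e' : 'cV[F]_n.+1)
    (y := k0 * k1 * k3 * (q * Q)) : Q != 0 ->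
  T I0 *m e = (k0^-1 * Q^-1 * (1 - Q) * (1 - k0 ^+ 2 * Q)) *: p
              + (k0 + k0^-1 - k0^-1 * Q^-1) *: e ->
  T I1 *m p = k1^-1 *: p ->
  T I3 *m e = k3 *: e ->
  T I1 *m e = - (k1 * (1 - Q) * (1 - k0 ^+ 2 * Q)) *: p
              + k1 *: e + k1^-1 *: o ->
  T I0 *m o = (k0^-1 * (q ^+ 2 * Q)^-1) *: (o - e') ->
  [/\ T I2 *m e = y^-1 *: (e - o),
      T I1 *m o = k1^-1 *: o,
      T I2 *m o = ((y - k2) * (y - k2^-1) / y) *: e
                  + (k2 + k2^-1 - y^-1) *: o
    & T I3 *m o = - (k3^-1 * (y - k2) * (y - k2^-1)) *: e
                  + k3^-1 *: o + k3 *: e'] /\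
  [/\ T I0 *m e' = (k0^-1 * (q ^+ 2 * Q)^-1 * (1 - q ^+ 2 * Q)
                       * (1 - k0 ^+ 2 * (q ^+ 2 * Q))) *: o
                   + (k0 + k0^-1 - k0^-1 * (q ^+ 2 * Q)^-1) *: e'
    & T I3 *m e' = k3 *: e'].
Proof.
move=> hQ T0e T1p T3e T1e T0o.
have hy : y != 0 by rewrite !mulf_neq0.
have T1o : T I1 *m o = k1^-1 *: o.
  have -> : o = k1 *: (T I1 *m e + (k1 * (1 - Q) * (1 - k0 ^+ 2 * Q)) *: p
                       - k1 *: e).
    by rewrite T1e; apply/colP=> r; rewrite !mxE; field.
  rewrite !mx_linE quadratic_mulmx T1p /=; move: (T I1 *m e) => u.
  by apply/colP=> r; rewrite !mxE; field.
(* Cancel t_0 and t_1 in t_0 t_1 t_2 t_3 e = q^-1 e. *)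
have T2e : T I2 *m e = y^-1 *: (e - o).
  have := prod_mulmx e; rewrite T3e !mx_linE => E.
  have {}E : T I0 *m (T I1 *m (T I2 *m e)) = (k3^-1 * q^-1) *: e.
    by rewrite -scalerA -E scalerA mulVf // scale1r.
  rewrite (quadratic_solve (quadratic_solve E)) /y /=.
  rewrite !(mx_linE, T0e, T1e, T1p, T1o).
  by apply/colP=> r; rewrite !mxE; field; rewrite ?hk0 ?hk1 ?hk3 ?hq ?hQ.
have T2o : T I2 *m o = ((y - k2) * (y - k2^-1) / y) *: e
                  + (k2 + k2^-1 - y^-1) *: o.
  have -> : o = e - y *: (T I2 *m e).
    by rewrite T2e scalerA divff // scale1r subKr.
  rewrite !mx_linE quadratic_mulmx /=; move: (T I2 *m e) => u.
  by clearbody y; apply/colP=> r; rewrite !mxE; field; rewrite ?hk2 ?hy.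
(* t_2 sends o - a e to a multiple of o and t_0 t_1 sends o to a multiple of
   o - e', so the rotated product relation gives t_3 (o - e').  Then o is a
   combination of t_3 (o - e') and e, so the quadratic relation gives t_3 o. *)
pose a := (y - k2) * (y - k2^-1).
have T3z : T I3 *m (o - e') = k3^-1 *: (o - a *: e).
  have T2x : T I2 *m (o - a *: e) = y *: o.
    rewrite !(mx_linE, T2e, T2o) /a; clearbody y.
    by apply/colP=> r; rewrite !mxE; field; rewrite ?hk2 ?hy.
  have := prod_mulmx_rot (o - a *: e).
  rewrite T2x -!scalemxAr T1o -!scalemxAr T0o -!scalemxAr => E.
  apply: (scalerI (invr_neq0 hq)); rewrite !scalerA mulrC -scalerA -E !scalerA.
  rewrite -[LHS]scale1r scalerA; congr (_ *: _).
  by rewrite /y; field; rewrite ?hk0 ?hk1 ?hk3 ?hq ?hQ.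
have defo : o = k3 *: (T I3 *m (o - e')) + a *: e.
  by rewrite T3z scalerA divff // scale1r subrK.
have T3o : T I3 *m o = - (k3^-1 * (y - k2) * (y - k2^-1)) *: e
                  + k3^-1 *: o + k3 *: e'.
  rewrite {1}defo mulmxDr -scalemxAr quadratic_mulmx T3z -scalemxAr T3e /= /a.
  clearbody y; apply/colP=> r; rewrite !mxE; field; by rewrite ?hk2 ?hk3.
have T3e' : T I3 *m e' = k3 *: e'.
  have -> : T I3 *m e' = T I3 *m o - T I3 *m (o - e') by rewrite mulmxBr subKr.
  rewrite T3o T3z /a; clearbody y; apply/colP=> r; rewrite !mxE; field.
  by rewrite ?hk2 ?hk3.
split; split=> //.
have dd : k0 * (q ^+ 2 * Q) != 0 by rewrite !mulf_neq0 ?expf_neq0.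
have defe' : e' = o - (k0 * (q ^+ 2 * Q)) *: (T I0 *m o).
  by rewrite T0o scalerA -invfM divff // scale1r subKr.
rewrite [in LHS]defe' mulmxBr -scalemxAr quadratic_mulmx T0o /=.
by apply/colP=> r; rewrite !mxE; field; rewrite ?hk0 ?hq ?hQ.
Qed.

(** The pairs (w_(2j-1), w_(2j)), each w_i being read off the formula for t_1 or
    t_0 at w_(i-1).  The first pair has 0 as its odd member, because
    [standard_step] requires t_1 p = k_1^-1 p. *)
Fixpoint verma_pair (w0 : 'cV[F]_n.+1) (j : nat) : 'cV[F]_n.+1 * 'cV[F]_n.+1 :=
  if j is i.+1 then
    let: (p, e) := verma_pair w0 i in
    let Q := q ^+ i.*2 in
    let o := k1 *: (T I1 *m e + (k1 * (1 - Q) * (1 - k0 ^+ 2 * Q)) *: p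
                    - k1 *: e) in
    (o, o - (k0 * (q ^+ 2 * Q)) *: (T I0 *m o))
  else (0, w0).

Lemma standard_family_exists (w0 : 'cV[F]_n.+1) :
  T I0 *m w0 = k0 *: w0 -> T I3 *m w0 = k3 *: w0 ->
  exists2 w, w 0%N = w0 & standard_family w.
Proof.
move=> T0w T3w; pose pr := verma_pair w0.
have inT1 j : T I1 *m (pr j).2 =
     - (k1 * (1 - q ^+ j.*2) * (1 - k0 ^+ 2 * q ^+ j.*2)) *: (pr j).1
     + k1 *: (pr j).2 + k1^-1 *: (pr j.+1).1.
  rewrite /pr /=; case: verma_pair => p e /=; rewrite scalerA mulVf // scale1r.
  by move: (T I1 *m e) => u; apply/colP=> r; rewrite !mxE; ring.
have inT0 j : T I0 *m (pr j.+1).1 =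
     (k0^-1 * (q ^+ 2 * q ^+ j.*2)^-1) *: ((pr j.+1).1 - (pr j.+1).2).
  rewrite /pr /=; case: verma_pair => p e /=.
  by rewrite subKr scalerA -invfM mulVf ?scale1r // !mulf_neq0 ?expf_neq0.
have inv j : [/\ T I0 *m (pr j).2 =
      (k0^-1 * q ^- j.*2 * (1 - q ^+ j.*2) * (1 - k0 ^+ 2 * q ^+ j.*2))
          *: (pr j).1
      + (k0 + k0^-1 - k0^-1 * q ^- j.*2) *: (pr j).2,
      T I1 *m (pr j).1 = k1^-1 *: (pr j).1
    & T I3 *m (pr j).2 = k3 *: (pr j).2].
  elim: j => [|j [T0e T1p T3e]].
    split=> //=; last by rewrite mulmx0 scaler0.
    by rewrite scaler0 add0r invr1 mulr1 addrK.
  have [[_ ? _ _] []] :=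
    standard_step (expf_neq0 _ hq) T0e T1p T3e (inT1 j) (inT0 j).
  by rewrite -exprD.
pose w i := if odd i then (pr i.+1./2).1 else (pr i./2).2.
have wE l : w l.*2 = (pr l).2 by rewrite /w odd_double doubleK.
have wO l : w l.*2.+1 = (pr l.+1).1.
  by rewrite /w /= odd_double /= doubleK.
have wP l (a b : F) : (a * (1 - q ^+ l.*2) * b) *: w l.*2.-1
                      = (a * (1 - q ^+ l.*2) * b) *: (pr l).1.
  case: l => [|l]; [by rewrite subrr mulr0 mul0r !scale0r | by rewrite -wO].
exists w => //; split=> j oj.
  have -> : j = j./2.*2 by rewrite -[LHS]odd_double_half (negPf oj).
  move: {j oj} j./2 => l; have [T0e T1p T3e] := inv l.
  have [[T2e _ _ _] _] :=
    standard_step (expf_neq0 _ hq) T0e T1p T3e (inT1 _) (inT0 _).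
  split.
  - by rewrite wP wE.
  - by rewrite scaleNr wP wE wO inT1 scaleNr.
  - by rewrite wE wO T2e exprS !invfM.
  - by rewrite wE.
have -> : j = j./2.*2.+1 by rewrite -[LHS]odd_double_half oj.
move: {j oj} j./2 => l; have [T0e T1p T3e] := inv l.
have [[_ T1o T2o T3o] _] :=
  standard_step (expf_neq0 _ hq) T0e T1p T3e (inT1 _) (inT0 _).
rewrite -doubleS !wE doubleS wO; split=> //.
- by rewrite inT0 -exprD.
- by rewrite T2o !exprS !invfM.
- by rewrite T3o exprS.
Qed.
End StandardFamily.

(** * The polynomial in t_0 t_1 that ends the sequence *)

Section CharPoly.
Variables (F : fieldType) (q k0 k1 : F).

Definition verma_factor (j : nat) : {poly F} :=
  ('X - ((k0 * k1 * q ^+ j.*2.+2)^-1)%:P) * ('X - (k0 * k1 * q ^+ j.*2)%:P).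

Definition verma_poly (m : nat) : {poly F} := \prod_(j < m) verma_factor j.

(** When k_0^2 = q^(-2m), the roots (k_0 k_1 q^(2j+2))^-1 are the numbers
    k_0 k_1^-1 q^(2j), listed in the opposite order; hence the symmetry in k_1
    and k_1^-1. *)
Lemma verma_polyE m : q != 0 -> k0 != 0 -> k1 != 0 ->
  k0 ^+ 2 = q ^- m.*2 ->
  verma_poly m = \prod_(j < m) ('X^2 - (k0 * q ^+ j.*2 * (k1 + k1^-1)) *: 'X
                                + ((k0 * q ^+ j.*2) ^+ 2)%:P).
Proof.
move=> hq hk0 hk1 hk.
pose G (a : F) (j : 'I_m) : {poly F} := 'X - (k0 * a * q ^+ j.*2)%:P.
have -> : verma_poly m = (\prod_j G k1^-1 j) * (\prod_j G k1 j).
  rewrite /verma_poly big_split /=; congr (_ * _).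
  rewrite [RHS](reindex_inj rev_ord_inj) /=; apply: eq_bigr => j _.
  rewrite /G /=; congr ('X - _%:P).
  have E : q ^+ m.*2 = q ^+ j.*2.+2 * q ^+ (m - j.+1).*2.
    by rewrite -doubleS -exprD -doubleD subnKC.
  have E1 : k0 ^+ 2 * (q ^+ j.*2.+2 * q ^+ (m - j.+1).*2) = 1.
    by rewrite -E hk mulVf ?expf_neq0.
  have hQ : q ^+ j.*2.+2 != 0 by rewrite expf_neq0.
  have hy := mulf_neq0 (mulf_neq0 hk0 hk1) hQ.
  apply: (mulfI hy); rewrite divff // -E1; field; exact: hk1.
rewrite -big_split; apply: eq_bigr => j _; rewrite /G /=.
have -> : k0 * q ^+ j.*2 * (k1 + k1^-1)
        = k0 * k1 * q ^+ j.*2 + k0 * k1^-1 * q ^+ j.*2.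
  by ring.
have -> : (k0 * q ^+ j.*2) ^+ 2
        = k0 * k1 * q ^+ j.*2 * (k0 * k1^-1 * q ^+ j.*2).
  by field; exact: hk1.
move: (k0 * k1 * _) (k0 * k1^-1 * _) => a b.
by rewrite -mul_polyC !rmorphD rmorphM /=; ring.
Qed.

End CharPoly.

Section Eigen.
Variables (F : fieldType) (q : F) (n : nat) (k0 k1 k2 k3 : F).
Variable T : daha_index -> 'M[F]_n.+1.
Variable w : nat -> 'cV[F]_n.+1.
Hypotheses (hq : q != 0) (hk0 : k0 != 0) (hk1 : k1 != 0).
Hypothesis wP : standard_family q k0 k1 k2 k3 T w.

Local Notation X := (T I0 * T I1).
Local Notation theta j := (k0 * k1 * q ^+ j).
Let mx_linE := (mulmxDr, mulmxN, =^~ scalemxAr).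

Lemma theta_neq0 j : theta j != 0.
Proof. exact: mulf_neq0 (mulf_neq0 hk0 hk1) (expf_neq0 _ hq). Qed.

(** On a standard family, 1 - k_0 k_1 q^(j+1) X moves w_j to w_(j+1) for j odd,
    and 1 - k_0 k_1 q^j X^-1 does so for j even. *)
Lemma X_odd j : odd j -> X *m w j = (theta j.+1)^-1 *: (w j - w j.+1).
Proof.
move=> oj; have [_ /(_ _ oj)[T0 T1 _ _]] := wP.
by rewrite -mulmxA T1 -scalemxAr T0 scalerA !invfM; congr (_ *: _); ring.
Qed.

Lemma X_even j : ~~ odd j -> X *m w j.+1 = X *m w j - theta j *: w j.
Proof.
move=> ej; have [/(_ _ ej)[T0 T1 _ _] _] := wP.
(* The formula for t_0 w_(j-1) may fail at j = 0, where its coefficient is 0. *)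
have T0p : ((1 - q ^+ j) * (1 - k0 ^+ 2 * q ^+ j)) *: (T I0 *m w j.-1)
         = ((1 - q ^+ j) * (1 - k0 ^+ 2 * q ^+ j)) *:
           ((k0^-1 * q ^- j) *: (w j.-1 - w j)).
  case: j ej {T0 T1} => [|j ej]; first by rewrite subrr mul0r !scale0r.
  have [_ /(_ j)[|-> //]] := wP; by rewrite -[odd j]negbK.
have [_ /(_ j.+1 ej)[_ T1o _ _]] := wP.
rewrite -!mulmxA T1 T1o !mx_linE -(mulrA k1) -mulNr.
rewrite -[(- k1 * _) *: _]scalerA T0p T0.
have := expf_neq0 j hq; move: (q ^+ j) => Q hQ.
apply/colP=> r; rewrite !mxE; field; by rewrite ?hk0 ?hk1 ?hQ.
Qed.

(** Eliminate w_(2j+1) between [X_even] and [X_odd]. *)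
Lemma X_step j : X *m w j.*2.+2 =
  - theta j.*2.+2 *: (horner_mx X (verma_factor q k0 k1 j) *m w j.*2).
Proof.
have ej : ~~ odd j.*2 by rewrite odd_double.
have -> : w j.*2.+2 = w j.*2.+1 - theta j.*2.+2 *: (X *m w j.*2.+1).
  by rewrite X_odd //= scalerA divff ?theta_neq0 // scale1r subKr.
rewrite rmorphM !rmorphB /= horner_mx_X !horner_mx_C.
rewrite -[in RHS]mulmxA [Z in _ = _ *: (_ *m Z)]mulmxBl mul_scalar_mx.
rewrite -X_even //.
rewrite [in RHS]mulmxBl mul_scalar_mx.
by rewrite mulmxBr -scalemxAr scalerBr scalerA mulNr divff ?theta_neq0 //
   scaleN1r opprK scaleNr addrC.
Qed.

Lemma horner_mx_mulmxC (A : 'M[F]_n.+1) (p : {poly F}) (x : 'cV_n.+1) :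
  horner_mx A p *m (A *m x) = A *m (horner_mx A p *m x).
Proof.
by rewrite !mulmxA; congr (_ *m _); apply/esym/comm_mx_horner.
Qed.

(** w_(2j) itself is a polynomial in X and X^-1 applied to w_0; the power of X
    clears the inverses. *)
Lemma Xpow_even j : exists2 c, c != 0 &
  X ^+ j *m w j.*2 = c *: (horner_mx X (verma_poly q k0 k1 j) *m w 0).
Proof.
elim: j => [|j [c c0 IH]].
  exists 1; rewrite ?oner_eq0 // /verma_poly big_ord0 rmorph1 !mul1mx.
  by rewrite scale1r.
exists (- theta j.*2.+2 * c); first by rewrite mulf_neq0 // oppr_eq0 theta_neq0.
have XX p : X ^+ j *m horner_mx X p = horner_mx X p *m X ^+ j.
  by apply/comm_mx_horner/esym/commrX.
rewrite exprSr -mulmxA doubleS X_step -scalemxAr mulmxA XX -mulmxA IH.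
rewrite -scalemxAr scalerA mulmxA; congr (_ *: (_ *m _)).
rewrite /verma_poly big_ord_recr /= -/(verma_poly q k0 k1 j) mulrC.
exact/esym/rmorphM.
Qed.

Hypothesis uX : X \is a GRing.unit.

Lemma mulmx_unit_eq0 (A : 'M[F]_n.+1) (x : 'cV_n.+1) :
  A \is a GRing.unit -> A *m x = 0 -> x = 0.
Proof.
by move=> uA Ax; rewrite -[x]mul1mx -[1%:M](mulVr uA) -mulmxA Ax mulmx0.
Qed.

Lemma family_last_eq0 m :
  (w m.*2 == 0) = (horner_mx X (verma_poly q k0 k1 m) *m w 0 == 0).
Proof.
have [c c0 E] := Xpow_even m.
apply/eqP/eqP=> [wm | Pw].
  move: E; rewrite wm mulmx0 => /esym/eqP.
  by rewrite scaler_eq0 (negPf c0) => /eqP.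
apply: (mulmx_unit_eq0 (unitrX m uX)).
by rewrite [LHS]E Pw scaler0.
Qed.

(** Every w_j lies in F[X, X^-1] w_0, by [X_odd] and [X_even]. *)
Lemma family_annihilated p : horner_mx X p *m w 0 = 0 ->
  forall j, horner_mx X p *m w j = 0.
Proof.
move=> P0; elim=> // j IH.
have [oj | ej] := boolP (odd j).
  have -> : w j.+1 = w j - theta j.+1 *: (X *m w j).
    by rewrite X_odd // scalerA divff ?theta_neq0 // scale1r subKr.
  by rewrite mulmxBr -scalemxAr horner_mx_mulmxC IH mulmx0 scaler0 subr0.
apply: (mulmx_unit_eq0 uX).
rewrite -horner_mx_mulmxC X_even // mulmxBr -scalemxAr horner_mx_mulmxC IH.
by rewrite mulmx0 scaler0 subr0.
Qed.
End Eigen.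

(** * Intertwining matrices and module isomorphisms *)

Section Intertwiner.
Variables (F : fieldType) (n : nat).
Variables (T T' : daha_index -> 'M[F]_n.+1) (P : 'M[F]_n.+1).
Hypotheses (uT : forall i, T i \is a GRing.unit)
           (uT' : forall i, T' i \is a GRing.unit).
Hypothesis TP : forall i, T i *m P = P *m T' i.

Lemma daha_eval_intertwine x :
  daha_eval T (fun i => (T i)^-1) x *m P
  = P *m daha_eval T' (fun i => (T' i)^-1) x.
Proof.
elim: x => [c | i | i | x IHx y IHy | x IHx y IHy] /=.
- by rewrite -scalemxAl -scalemxAr mul1mx mulmx1.
- exact: TP.
- rewrite -[LHS]mulr1 -[1](mulrV (uT' i)) mulrA.
  congr (_ *m _); rewrite -[RHS]mul1r -[1](mulVr (uT i)) -!mulrA.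
  by congr (_ *m _); apply/esym/TP.
- by rewrite mulmxDl IHx IHy mulmxDr.
- by rewrite -mulmxA IHy mulmxA IHx mulmxA.
Qed.

End Intertwiner.

Section ModuleIso.
Variables (F : fieldType) (q : F) (d : nat).
Variables (k0 k1 k2 k3 k0' k1' k2' k3' : F).
Variables (hq : q != 0) (hd : odd d).
Variables (hk0 : k0 != 0) (hk1 : k1 != 0) (hk2 : k2 != 0) (hk3 : k3 != 0).
Variables (hk0' : k0' != 0) (hk1' : k1' != 0).
Variables (hk2' : k2' != 0) (hk3' : k3' != 0).
Variables (hk : k0 ^+ 2 = q ^- d.+1) (hk' : k0' ^+ 2 = q ^- d.+1).

Local Notation M := (E k0 k1 k2 k3 hq hd hk0 hk1 hk2 hk3 hk).
Local Notation M' := (E k0' k1' k2' k3' hq hd hk0' hk1' hk2' hk3' hk').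
Local Notation T := (t_mx q d k0 k1 k2 k3).
Local Notation T' := (t_mx q d k0' k1' k2' k3').
Let uT i : T i \is a GRing.unit := t_mx_unit hd hk0 hk1 hk2 hk3 hk i.
Let uT' i : T' i \is a GRing.unit := t_mx_unit hd hk0' hk1' hk2' hk3' hk' i.

Variable P : 'M[F]_d.+1.
Hypothesis TP : forall i, T i *m P = P *m T' i.

Let PZ (h : daha hq) (x : 'cV[F]_d.+1) :
  P *m (h *: (x : M') : M') = h *: (P *m x : M).
Proof.
rewrite /GRing.scale /= /E_scale !mulmxA; congr (_ *m _).
exact/esym/(daha_eval_intertwine uT uT' TP).
Qed.

(** As in the lemma of Schur: the column space of P is a nonzero submodule of M,
    hence all of M. *)
Lemma intertwiner_unit : irreducible_module M -> P != 0 -> P \in unitmx.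
Proof.
case=> _ irr P0.
pose S : {pred M} := fun x => ((x : 'cV[F]_d.+1)^T <= P^T)%MS.
have SP (x : 'cV[F]_d.+1) : P *m x \in S.
  by rewrite unfold_in /S trmx_mul submxMl.
have SE (x : M) : x \in S -> exists y : 'cV[F]_d.+1, x = P *m y.
  rewrite unfold_in => /submxP[D E]; exists D^T.
  by apply: trmx_inj; rewrite trmx_mul trmxK.
have cS : submod_closed S.
  split; first by rewrite -[0](mulmx0 _ P).
  move=> h u v /SE[a ->] /SE[b ->].
  by rewrite -PZ -mulmxDr.
case: (irr S cS) => SS.
  case/eqP: P0; apply: eq_on_v => j jd; rewrite mul0mx.
  by apply/eqP; have := SS (P *m daha_v F d j); rewrite SP => /esym.
rewrite -unitmx_tr -row_full_unit -sub1mx; apply/row_subP=> i.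
by have := SS ((row i 1%:M)^T); rewrite !unfold_in /S trmxK => ->.
Qed.

(** P goes from M' to M, so the isomorphism is given by its inverse. *)
Lemma unit_intertwiner_isomorphic : P \in unitmx -> isomorphic_modules M M'.
Proof.
move=> uP.
pose f (x : M) : M' := invmx P *m (x : 'cV[F]_d.+1).
have fl : linear f.
  move=> h u v; apply: (can_inj (mulKmx uP)).
  by rewrite [RHS]mulmxDr PZ !mulKVmx.
pose fL := GRing.isLinear.Build _ _ _ _ f fl.
pose fH : {linear M -> M'} := HB.pack f fL.
exists fH; exists (fun x : M' => P *m (x : 'cV[F]_d.+1)).
  by move=> x; apply: mulKVmx.
by move=> x; apply: mulKmx.
Qed.
End ModuleIso.

(** * The homomorphism from E given by a terminating sequence *)

Section FamilyE.
Variables (F : fieldType) (q : F) (d : nat) (k0 k1 k2 k3 : F).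
Variables (hd : odd d) (hk0 : k0 != 0) (hk : k0 ^+ 2 = q ^- d.+1).
Local Notation T := (t_mx q d k0 k1 k2 k3).

Lemma t_mx_standard_family : standard_family q k0 k1 k2 k3 T (daha_v F d).
Proof.
split=> j oj.
  by rewrite t0_mx_even ?t1_mx_even ?t2_mx_even ?t3_mx_even.
by rewrite t0_mx_odd ?t1_mx_odd ?t2_mx_odd ?t3_mx_odd.
Qed.

Variables (n : nat) (S : daha_index -> 'M[F]_n.+1) (w : nat -> 'cV[F]_n.+1).
Hypothesis wP : standard_family q k0 k1 k2 k3 S w.
Hypothesis wd : w d.+1 = 0.

Definition family_mx : 'M[F]_(n.+1, d.+1) := \matrix_(r, j) w j r 0.

Lemma family_mxE j : (j <= d.+1)%N -> family_mx *m daha_v F d j = w j.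
Proof.
rewrite leq_eqVlt => /orP[/eqP -> | jd].
  by rewrite wd daha_v_out ?mulmx0.
apply/colP=> r; rewrite mxE (bigD1 (Ordinal jd)) //= !mxE eqxx mulr1.
rewrite big1 ?addr0 // => s nsj.
by rewrite !mxE -(inj_eq val_inj) /= in nsj *; rewrite (negPf nsj) mulr0.
Qed.

Lemma family_intertwine i : S i *m family_mx = family_mx *m T i.
Proof.
have [we wo] := wP; have [ve vo] := t_mx_standard_family.
apply: eq_on_v => j jd; rewrite -!mulmxA family_mxE ?(leqW jd) //.
have Fp : family_mx *m daha_v F d j.-1 = w j.-1.
  by rewrite family_mxE // (leq_trans (leq_pred j)) ?leqW.
have Fn : family_mx *m daha_v F d j.+1 = w j.+1 by rewrite family_mxE.
have Fj : family_mx *m daha_v F d j = w j by rewrite family_mxE ?leqW.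
have FE := (mulmxDr, mulmxN, =^~ scalemxAr, Fp, Fj, Fn).
have [oj | ej] := boolP (odd j).
  have [w0 w1 w2 w3] := wo _ oj; have [v0 v1 v2 v3] := vo _ oj.
  by case: i; rewrite ?(w0, w1, w2, w3, v0, v1, v2, v3) !FE.
have [w0 w1 w2 w3] := we _ ej; have [v0 v1 v2 v3] := ve _ ej.
by case: i; rewrite ?(w0, w1, w2, w3, v0, v1, v2, v3) !FE.
Qed.
End FamilyE.

(** * A common eigenvector of t_0 and t_3 for k_0 and k_3^-1 *)

(** There are m equations in m + 1 unknowns.  Either the last equation can be
    solved for the new unknown, or its coefficient b m is 0 and the new unknown,
    which occurs nowhere else, is free. *)
Lemma bidiagonal_kernel (F : fieldType) (a b : nat -> F) (m : nat) :
  exists2 y : nat -> F, exists2 j, (j <= m)%N & y j != 0 &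
    forall j, (j < m)%N -> a j * y j + b j * y j.+1 = 0.
Proof.
elim: m => [|m [y [j jm yj] yP]].
  by exists (fun=> 1) => //; exists 0%N; rewrite ?oner_eq0.
have [b0 | b0] := eqVneq (b m) 0.
  exists (fun i => (i == m.+1)%:R).
    by exists m.+1; rewrite ?eqxx ?oner_eq0.
  move=> i; rewrite ltnS leq_eqVlt => /orP[/eqP -> | im].
    by rewrite b0 mul0r ltn_eqF // mulr0 addr0.
  by rewrite !ltn_eqF ?mulr0 ?addr0 ?ltnS // ltnW.
exists (fun i => if i == m.+1 then - (a m * y m) / b m else y i).
  by exists j; [exact: leqW | rewrite ltn_eqF].
move=> i; rewrite ltnS leq_eqVlt => /orP[/eqP -> | im].
  by rewrite eqxx ltn_eqF // mulrCA divff // mulr1 subrr.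
by rewrite !ltn_eqF ?ltnS ?yP // ltnW.
Qed.

Section Twist.
Variables (F : fieldType) (q : F) (d : nat) (k0 k1 k2 k3 : F).
Variables (hq : q != 0) (hd : odd d).
Variables (hk0 : k0 != 0) (hk1 : k1 != 0) (hk2 : k2 != 0) (hk3 : k3 != 0).
Variables (hk : k0 ^+ 2 = q ^- d.+1).
Local Notation M := (E k0 k1 k2 k3 hq hd hk0 hk1 hk2 hk3 hk).
Local Notation T := (t_mx q d k0 k1 k2 k3).

Let dE : d.+1 = (d.+1)./2.*2.
Proof. by rewrite -[LHS]odd_double_half /= hd. Qed.

Local Notation v := (daha_v F d).

(** The vectors s_0, ..., s_m below, with 2m = d + 1, are independent
    eigenvectors of t_0 for k_0, and t_3 - k_3^-1 maps each s_j to a combination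
    of v_(2j) and v_(2j-2), with v_(2m) = 0; so a combination of the s_j is
    killed as soon as its coefficients solve m bidiagonal equations. *)
Lemma eigenvector_inv : exists w0 : 'cV[F]_d.+1,
  [/\ w0 != 0, T I0 *m w0 = k0 *: w0 & T I3 *m w0 = k3^-1 *: w0].
Proof.
pose m := (d.+1)./2.
pose s j := if j == m then v d
            else v j.*2 + (q ^+ j.*2 - 1) *: v j.*2.-1.
pose y0 := k0 * k1 * k3.
pose g j := (y0 * q ^+ j - k2) * (y0 * q ^+ j - k2^-1).
pose a j := k3 * q ^+ j.*2 - k3^-1.
pose b j := if j.+1 == m then - (k3^-1 * g d)
            else (q ^+ j.+1.*2 - 1) * - (k3^-1 * g j.*2.+1).
have [Ve Vo] := t_mx_standard_family k1 k2 k3 hd hk0 hk.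
have vd1 : v d.+1 = 0 by rewrite daha_v_out.
have m0 : (0 < m)%N by rewrite /m; case: (d) hd.
have dm : d.+1 = m.*2 by exact: dE.
have T0s j : T I0 *m s j = k0 *: s j.
  rewrite /s; case: eqP => _.
    have [-> _ _ _] := Vo _ hd; rewrite vd1 subr0 -hk expr2 mulKf //.
  case: j => [|j].
    have [T0v _ _ _] := Ve 0%N isT.
    rewrite subrr scale0r addr0 T0v subrr mulr0 mul0r scale0r add0r.
    by rewrite invr1 mulr1 addrK.
  have ej : ~~ odd j.*2.+2 by rewrite /= negbK odd_double.
  have oj : odd j.*2.+1 by rewrite /= odd_double.
  have [T0e _ _ _] := Ve _ ej; have [T0o _ _ _] := Vo _ oj.
  rewrite mulmxDr -scalemxAr T0e /= T0o.
  have := expf_neq0 j.*2.+2 hq; move: (q ^+ _) => Q hQ.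
  by apply/colP=> r; rewrite !mxE; field; rewrite ?hk0 ?hQ.
have T3s j : (j <= m)%N -> T I3 *m s j - k3^-1 *: s j
    = a j *: v j.*2 + (if j is i.+1 then b i *: v i.*2 else 0).
  rewrite /s; case: eqP => [-> _ | /eqP jm _].
    have [_ _ _ T3d] := Vo _ hd.
    have dp : d.-1 = m.-1.*2 by rewrite -[d]/(d.+1.-1) dm; case: (m) m0.
    rewrite T3d -dm vd1 !scaler0 addr0 add0r addrK /b.
    by case: (m) m0 dp => // m1 _ /= ->; rewrite eqxx /g !mulrA.
  case: j jm => [|j] jm.
    have [_ _ _ T3v] := Ve 0%N isT.
    by rewrite subrr scale0r !addr0 T3v -scalerBl /a mulr1.
  have ej : ~~ odd j.*2.+2 by rewrite /= negbK odd_double.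
  have oj : odd j.*2.+1 by rewrite /= odd_double.
  have [_ _ _ T3e] := Ve _ ej; have [_ _ _ T3o] := Vo _ oj.
  rewrite mulmxDr -scalemxAr T3e /= T3o /b (negPf jm) /a /g -/y0 doubleS /=.
  move: (y0 * _ - k2) (y0 * _ - k2^-1) (q ^+ _) => A B Q.
  by apply/colP=> r; rewrite !mxE; field.
(* Independence: the coordinates of index 0, 2, ..., d - 1, d are dual to s. *)
have sE j l (jm : (j <= m)%N) (lm : (l <= m)%N) (ld : (minn d l.*2 < d.+1)%N) :
    s j (Ordinal ld) 0 = (j == l)%:R.
  rewrite /s; case: eqP => [jE | /eqP jE]; rewrite !mxE /=.
    by congr (_ : bool)%:R; lia.
  have -> : (minn d l.*2 == j.*2) = (j == l) by lia.
  case: j jE {jm} => [|j] jE; first by rewrite subrr mul0r addr0.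
  have -> : (minn d l.*2 == j.+1.*2.-1) = false by lia.
  by rewrite mulr0 addr0.
have [y [j0 j0m yj0] yP] := bidiagonal_kernel a b m.
exists (\sum_(j < m.+1) y j *: s j); split.
- apply: contraNneq yj0 => E.
  have ld : (minn d j0.*2 < d.+1)%N by rewrite ltnS geq_minl.
  have := congr1 (fun z : 'cV[F]_d.+1 => z (Ordinal ld) 0) E.
  rewrite summxE (bigD1 (Ordinal (j0m : (j0 < m.+1)%N))) //= big1.
    by rewrite !mxE sE // eqxx mulr1 addr0 => ->.
  move=> l nl; rewrite mxE sE ?leq_ord //.
  by rewrite -(inj_eq val_inj) /= in nl; rewrite (negPf nl) mulr0.
- rewrite mulmx_sumr scaler_sumr; apply: eq_bigr => j _.
  by rewrite -scalemxAr T0s !scalerA mulrC.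
apply/eqP; rewrite -subr_eq0 mulmx_sumr scaler_sumr -sumrB; apply/eqP.
transitivity (\sum_(j < m.+1) (y j * a j) *: v j.*2
  + \sum_(j < m.+1)
      (if nat_of_ord j is i.+1 then (y j * b i) *: v i.*2 else 0)).
  rewrite -big_split; apply: eq_bigr => j _ /=.
  rewrite -scalemxAr scalerA [k3^-1 * _]mulrC -[(y j / k3) *: _]scalerA.
  rewrite -scalerBr T3s ?leq_ord // scalerDr scalerA.
  by case: (nat_of_ord j) => [|i]; rewrite ?scaler0 ?scalerA.
rewrite big_ord_recr /= -dm vd1 scaler0 addr0 [X in _ + X]big_ord_recl /= add0r.
rewrite -big_split big1 // => j _ /=; rewrite -scalerDl.
by rewrite mulrC [y _.+1 * _]mulrC yP ?scale0r.
Qed.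

(** * Irreducible modules with inverted parameters *)

(** The sequence generated by w0 with the new parameters ends because the
    polynomial in t_0 t_1 governing it is the one that vanishes on M. *)
Lemma isomorphic_of_eigenvector (k1' k2' k3' : F) (hk1' : k1' != 0)
    (hk2' : k2' != 0) (hk3' : k3' != 0) (w0 : 'cV[F]_d.+1) :
  k1' + k1'^-1 = k1 + k1^-1 -> k2' + k2'^-1 = k2 + k2^-1 ->
  k3' + k3'^-1 = k3 + k3^-1 ->
  w0 != 0 -> T I0 *m w0 = k0 *: w0 -> T I3 *m w0 = k3' *: w0 ->
  irreducible_module M ->
  isomorphic_modules M (E k0 k1' k2' k3' hq hd hk0 hk1' hk2' hk3' hk).
Proof.
move=> c1 c2 c3 w0n T0w T3w irr.
have uT := t_mx_unit hd hk0 hk1 hk2 hk3 hk.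
have uX : T I0 * T I1 \is a GRing.unit by rewrite unitrMl uT.
have [w w0E wP] : exists2 w, w 0%N = w0 & standard_family q k0 k1' k2' k3' T w.
  apply: standard_family_exists => //; last exact: t_mx_prod.
  move=> i; rewrite t_mx_quadratic //; congr (_ *: _ - _).
  by case: i => /=.
have vP := t_mx_standard_family k1 k2 k3 hd hk0 hk.
have hk' : k0 ^+ 2 = q ^- (d.+1)./2.*2 by rewrite -dE.
have Pw0 : horner_mx (T I0 * T I1) (verma_poly q k0 k1' (d.+1)./2) = 0.
  have -> : verma_poly q k0 k1' (d.+1)./2 = verma_poly q k0 k1 (d.+1)./2.
    by rewrite !verma_polyE // c1.
  apply: eq_on_v => j _; rewrite mul0mx.
  apply: (family_annihilated hq hk0 hk1 vP uX); apply/eqP.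
  by rewrite -(family_last_eq0 hq hk0 hk1 vP uX) -dE daha_v_out.
have wd : w d.+1 = 0.
  apply/eqP; rewrite [X in w X]dE (family_last_eq0 hq hk0 hk1' wP uX).
  by rewrite Pw0 mul0mx.
have TP := family_intertwine hd hk0 hk wP wd.
apply: unit_intertwiner_isomorphic; first exact: TP.
apply: (intertwiner_unit hk0 hk1' hk2' hk3' hk TP irr).
by apply: contraNneq w0n => Phi0; rewrite -w0E -(family_mxE wd) // Phi0 mul0mx.
Qed.

End Twist.

Theorem theorem2p2 (F : fieldType) (q : F) (hq : q != 0)
    (d : nat) (d_ge1 : (1 <= d)%N) (hd : odd d)
    (k0 k1 k2 k3 : F) (hk0 : k0 != 0) (hk1 : k1 != 0)
    (hk2 : k2 != 0) (hk3 : k3 != 0) (hk : k0 ^+ 2 = q ^- d.+1) :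
  irreducible_module (E k0 k1 k2 k3 hq hd hk0 hk1 hk2 hk3 hk) ->
  [/\ isomorphic_modules
         (E k0 k1 k2 k3 hq hd hk0 hk1 hk2 hk3 hk)
         (E k0 k1^-1 k2 k3 hq hd hk0 (invr_neq0 hk1) hk2 hk3 hk),
      isomorphic_modules
         (E k0 k1 k2 k3 hq hd hk0 hk1 hk2 hk3 hk)
         (E k0 k1 k2^-1 k3 hq hd hk0 hk1 (invr_neq0 hk2) hk3 hk)
    & isomorphic_modules
         (E k0 k1 k2 k3 hq hd hk0 hk1 hk2 hk3 hk)
         (E k0 k1 k2 k3^-1 hq hd hk0 hk1 hk2 (invr_neq0 hk3) hk)].
Proof.
move=> irr.
have sumV (x : F) : x^-1 + x^-1^-1 = x + x^-1 by rewrite invrK addrC.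
have v0 : daha_v F d 0 != 0.
  apply/eqP => /colP /(_ ord0); rewrite !mxE /= => /eqP.
  by rewrite oner_eq0.
have T0v : t_mx q d k0 k1 k2 k3 I0 *m daha_v F d 0 = k0 *: daha_v F d 0.
  by rewrite t_mxE.
have T3v : t_mx q d k0 k1 k2 k3 I3 *m daha_v F d 0 = k3 *: daha_v F d 0.
  by rewrite t3_mx_even.
have [w0 [w0n T0w T3w]] := eigenvector_inv hq hd hk0 hk1 hk2 hk3 hk.
split.
- exact: (isomorphic_of_eigenvector _ _ _ (sumV k1) erefl erefl v0 T0v T3v).
- exact: (isomorphic_of_eigenvector _ _ _ erefl (sumV k2) erefl v0 T0v T3v).
- exact: (isomorphic_of_eigenvector _ _ _ erefl erefl (sumV k3) w0n T0w T3w).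
Qed.
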